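(* (i) For every fixed integer $d\ge 3$ there is $n_0=n_0(d)$ such that for all $n\ge n_0$ Maker has a winning strategy in the game $\mathcal{D}_d(1:b)$ on $K_n$ with $$b=\frac{1}{2d}\left(\frac{n}{\ln n}\right)^{1-1/\lceil d/2\rceil}.$$ (ii) For every integer $a>1$ and every integer $d\ge 3$ there exist constants $c_2=c_2(d)>0$ (depending only on $d$) and $c_3=c_3(a,d)>0$ such that, for all sufficiently large $n$, Breaker has a winning strategy in the game $\mathcal{D}_d(1:c_2 n^{1-1/(d-1)})$ on $K_n$ and Breaker has a winning strategy in the game $\mathcal{D}_d(a:c_3 n^{1-1/d})$ on $K_n$.
   Context: For positive integers $a,b,d$, the $d$-diameter game $\mathcal{D}_d(a:b)$ is the following two-player, perfect-information game on the edge set of the complete graph $K_n$ on $n$ vertices. Maker and Breaker alternately claim previously unclaimed edges, Maker moving first. In each of his turns Maker claims $a$ unclaimed edges, and in each of his turns Breaker claims $b$ unclaimed edges (a player claims all remaining edges if fewer remain than he should claim). The game ends when all edges of $K_n$ are claimed. Maker wins if and only if the graph on the $n$ vertices of $K_n$ formed by Maker's edges has diameter at most $d$ (a disconnected graph has infinite diameter); otherwise Breaker wins. When the expression given for Breaker's bias $b$ is not an integer, it is to be read as its integer part $\lfloor b\rfloor$. $\ln$ denotes the natural logarithm. *)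

(* Defs.v *)
From HB Require Import structures.
From mathcomp Require Import all_boot all_order all_algebra.
From mathcomp Require Import all_classical all_reals all_analysis.

Set Implicit Arguments.
Unset Strict Implicit.
Unset Printing Implicit Defensive.

Import Order.TTheory GRing.Theory Num.Theory.

Local Open Scope ring_scope.

Section BiasedGame.
Variables (T : finType) (board : {set T}) (a b : nat).

(* Players are encoded by the parity of their turns: Maker moves first. *)
Definition Maker : bool := false.
Definition Breaker : bool := true.

(* The list of moves made so far, in chronological order. *)
Definition history := seq {set T}.

Definition to_move (h : history) : bool := odd (size h).

Definition claimed_by (p : bool) (h : history) : {set T} :=
  (\bigcup_(i < size h | odd i == p) nth finset.set0 h i)%SET.

Definition unclaimed (h : history) : {set T} :=
  (board :\: (claimed_by Maker h :|: claimed_by Breaker h))%SET.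

Definition game_over (h : history) : bool := unclaimed h == finset.set0.

Definition bias (p : bool) : nat := if p == Maker then a else b.

Definition legal_move (h : history) (m : {set T}) : bool :=
  [&& ~~ game_over h, m \subset unclaimed h
    & #|m| == minn (bias (to_move h)) #|unclaimed h|].

Definition legal_play (h : history) : Prop :=
  forall i, (i < size h)%N -> legal_move (take i h) (nth finset.set0 h i).

Definition strategy := history -> {set T}.

Definition follows (p : bool) (s : strategy) (h : history) : Prop :=
  forall i, (i < size h)%N -> to_move (take i h) = p ->
    nth finset.set0 h i = s (take i h).

(* The first clause is needed because otherwise a strategy proposing illegal
   moves would win vacuously: no finished play would follow it. *)
Definition winning_strategy (p : bool) (win : history -> Prop) (s : strategy) :
    Prop :=
  (forall h, legal_play h -> follows p s h -> to_move h = p -> ~~ game_over h ->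
     legal_move h (s h)) /\
  (forall h, legal_play h -> follows p s h -> game_over h -> win h).

End BiasedGame.

Section Diameter.
Variables (R : realType) (V : finType) (e : rel V).

(* The infimum of the empty set of extended reals is +oo, so a disconnected
   graph has diameter +oo. *)
Definition distance (x y : V) : \bar R :=
  ereal_inf [set ((size p)%:R)%:E | p in
    [set p : seq V | path e x p /\ last x p = y]%classic]%classic.

Definition diameter : \bar R :=
  ereal_sup [set distance xy.1 xy.2 | xy in [set: V * V]%classic]%classic.

End Diameter.

Section DiameterGame.
Variables (R : realType) (d a b n : nat).

Definition complete_edges : {set {set 'I_n}} :=
  [set e : {set 'I_n} | #|e| == 2%N]%SET.

Definition adjacent (E : {set {set 'I_n}}) : rel 'I_n :=
  fun x y => [set x; y]%SET \in E.

Definition maker_wins (h : history {set 'I_n}) : Prop :=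
  (diameter R (adjacent (claimed_by Maker h)) <= (d%:R)%:E)%E.

Definition Maker_has_winning_strategy : Prop :=
  exists s, winning_strategy complete_edges a b Maker maker_wins s.

Definition Breaker_has_winning_strategy : Prop :=
  exists s, winning_strategy complete_edges a b Breaker
              (fun h => ~ maker_wins h) s.

End DiameterGame.

(* Main.v *)
Require Import Defs.
From HB Require Import structures.
From mathcomp Require Import all_boot all_order all_algebra.
From mathcomp Require Import all_classical all_reals all_analysis.
From mathcomp Require Import fintype finset zify ring lra.

Set Implicit Arguments.
Unset Strict Implicit.
Unset Printing Implicit Defensive.

Import Order.TTheory GRing.Theory Num.Theory.

Local Open Scope ring_scope.

(** Winning strategies are obtained from invariants of plays
    ([invariant_wins]), and the diameter is at most [d] exactly when every ball of
    radius [d] contains all vertices ([diameter_le]).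

    Maker. Put [k = uphalf d], [L = ln n] and [X = (n / L)^(1/k)], so that
    [n = X^k L] and the bias is at most [beta = X^(k-1) / (2 d)]. Maker follows a
    potential strategy ([potential_wins]): a family of sets of edges carries
    weights which fall when Maker takes an edge of the set and rise when Breaker
    does, and Maker takes the edge that lowers the sum of the weights most. Before
    each move of Maker this sum then does not exceed its initial value, which is below [1]
    ([initial_potential_lt1]), so at the end no set weighs [1] or more. The family
    consists of the stars, whose final weights force all degrees in Maker's graph
    to be at least [1.4 X L] ([ball1_large]), and of the bundles of all edges
    between two disjoint sets large enough for a union bound, each of which must
    contain an edge of Maker ([heavy_crossed]). Bundles that leave a ball make the
    balls of Maker's graph grow by a factor [X] per step ([ball_grows]), up to
    [1.4 X^(k-1) L] vertices at radius [k - 1]. Two disjoint balls of that size are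
    joined by an edge, which gives distance at most [2 k - 1 <= d]
    ([maker_graph_ball]).

    Breaker. When Maker claims an edge, Breaker claims [r] edges at each of its
    ends. Then no degree in Maker's graph exceeds about [n / r]
    ([balanced_maker_move], [payable_breaker_move]). If [r] is of order
    [n^(1 - 1/d)], with a large constant, then the degrees are below [n^(1/d)]
    and a ball of radius [d] cannot contain all vertices
    ([breaker_wins_by_degrees]).

    If Maker claims a single edge per turn, then degrees up to order
    [n^(1/(d-1))] can be afforded ([breaker_wins_by_threats]). Breaker fixes two
    vertices [x] and [y] that Maker's first edge does not touch, and after each
    move of Maker claims every pair whose addition to Maker's graph would bring [x]
    and [y] within distance [d]. One edge of Maker never achieves this by itself
    ([far_maker_move]), and by the bound on the degrees it creates only
    [O(n^((d-2)/(d-1)))] new pairs of this kind ([new_threats]), which the bias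
    covers. *)

(** * Plays and invariants *)

Section Histories.
Variables (T : finType) (board : {set T}) (a b : nat).
Implicit Types (h : history T) (m : {set T}) (p : bool).

Lemma claimed_by_nil p : claimed_by p ([::] : history T) = set0.
Proof. by apply: big1 => -[]. Qed.

Lemma claimed_by_rcons p h m :
  claimed_by p (rcons h m) =
  (claimed_by p h :|: if to_move h == p then m else set0)%SET.
Proof.
rewrite /claimed_by size_rcons big_mkcond big_ord_recr /= -big_mkcond /=.
rewrite nth_rcons ltnn eqxx /to_move; congr (_ :|: _)%SET.
apply: eq_big => // i _; by rewrite nth_rcons ltn_ord.
Qed.

Lemma all_prefixes_rcons (Q : history T -> {set T} -> Prop) h m :
  (forall i, (i < size (rcons h m))%N ->
     Q (take i (rcons h m)) (nth set0 (rcons h m) i)) <->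
  (forall i, (i < size h)%N -> Q (take i h) (nth set0 h i)) /\ Q h m.
Proof.
have E i : (i < size h)%N -> take i (rcons h m) = take i h.
  by move=> ih; rewrite -cats1 takel_cat // ltnW.
have E0 : take (size h) (rcons h m) = h by rewrite -cats1 take_size_cat.
split=> [Qh|[Qh Qm] i].
  split=> [i ih|].
    have := Qh i; rewrite size_rcons ltnS nth_rcons ih E //.
    by apply; apply: ltnW.
  by have := Qh (size h); rewrite size_rcons ltnS leqnn nth_rcons ltnn eqxx E0; apply.
rewrite size_rcons ltnS leq_eqVlt nth_rcons => /orP[/eqP->|ih].
  by rewrite ltnn eqxx E0.
by rewrite ih E //; apply: Qh.
Qed.

Lemma legal_play_rcons h m :
  legal_play board a b (rcons h m) <->
  legal_play board a b h /\ legal_move board a b h m.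
Proof. exact: (all_prefixes_rcons (legal_move board a b)). Qed.

Lemma follows_rcons p (s : strategy T) h m :
  follows p s (rcons h m) <-> follows p s h /\ (to_move h = p -> m = s h).
Proof. exact: (all_prefixes_rcons (fun h' m' => to_move h' = p -> m' = s h')). Qed.

Lemma claimed_sub p h : legal_play board a b h -> claimed_by p h \subset board.
Proof.
elim/last_ind: h => [_|h m IH]; first by rewrite claimed_by_nil sub0set.
move=> /legal_play_rcons[lh /and3P[_ sm _]].
rewrite claimed_by_rcons subUset IH //=; case: ifP => _; rewrite ?sub0set //.
exact: subset_trans sm (subsetDl _ _).
Qed.

Lemma unclaimed_rcons h m :
  unclaimed board (rcons h m) = (unclaimed board h :\: m)%SET.
Proof.
rewrite /unclaimed !claimed_by_rcons; apply/setP => z; rewrite !inE.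
by case: (to_move h) => /=; rewrite ?inE; do !case: (z \in _).
Qed.

(** A player who can always move so as to keep [inv] true has a winning strategy
    in the sense of strategies on histories: choose such a move whenever there
    is one. This reduces both halves of the theorem to exhibiting invariants. *)
Lemma invariant_wins p (win inv : history T -> Prop) :
  inv [::] ->
  (forall h m, legal_play board a b h -> inv h -> to_move h = ~~ p ->
     legal_move board a b h m -> inv (rcons h m)) ->
  (forall h, legal_play board a b h -> inv h -> to_move h = p ->
     ~~ game_over board h ->
     exists2 m, legal_move board a b h m & inv (rcons h m)) ->
  (forall h, legal_play board a b h -> inv h -> game_over board h -> win h) ->
  exists s, winning_strategy board a b p win s.
Proof.
move=> inv0 invO invP invW.
pose good h m := legal_move board a b h m /\ inv (rcons h m).
pose s h := xget set0 (good h).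
have sP h : legal_play board a b h -> inv h -> to_move h = p ->
    ~~ game_over board h -> good h (s h).
  by move=> lh ih th gh; have [m lm im] := invP h lh ih th gh;
    apply: (@xgetPex _ set0 (good h)); exists m.
have invs h : legal_play board a b h -> follows p s h -> inv h.
  elim/last_ind: h => // h m IH /legal_play_rcons[lh lm] /follows_rcons[fh ms].
  have ih := IH lh fh; case: (eqVneq (to_move h) p) => [th|th].
    rewrite ms //; apply: (sP h lh ih th _).2.
    by case/and3P: lm.
  by apply: invO => //; move: th; case: (to_move h); case: (p).
exists s; split=> h lh fh.
  by move=> th gh; case: (sP h lh (invs h lh fh) th gh).
exact/invW/invs.
Qed.

End Histories.

(** * Balls in graphs *)

Lemma card_bigcup_le (I T : finType) (P : pred I) (F : I -> {set T}) :
  (#|(\bigcup_(i | P i) F i)%SET| <= \sum_(i | P i) #|F i|)%N.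
Proof.
elim/big_rec2: _ => [|i n U _ leUn]; first by rewrite cards0.
by rewrite (leq_trans (leq_card_setU _ _).1) ?leq_add2l.
Qed.

Section Balls.
Variable V : finType.
Implicit Types (e : rel V) (x y z : V) (r : nat).

Fixpoint wball e r x : {set V} :=
  if r is s.+1 then
    (wball e s x :|: [set z | [exists y in wball e s x, e y z]])%SET
  else [set x]%SET.

Lemma wballSP e r x z :
  reflect (z \in wball e r x \/ exists2 y, y \in wball e r x & e y z)
          (z \in wball e r.+1 x).
Proof.
rewrite /= !inE; apply: (iffP orP) => -[]; try by left.
  by move=> /existsP[y /andP[yb eyz]]; right; exists y.
by case=> y yb eyz; right; apply/existsP; exists y; rewrite yb.
Qed.

Lemma wball_center e r x : x \in wball e r x.
Proof. by elim: r => [|r IH] /=; rewrite !inE // IH. Qed.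

Lemma sub_wball e r s x : (r <= s)%N -> wball e r x \subset wball e s x.
Proof.
move=> /subnK <-; elim: (s - r)%N => // k IH.
exact: subset_trans IH (subsetUl _ _).
Qed.

Lemma wball_le e r s x z : (r <= s)%N -> z \in wball e r x -> z \in wball e s x.
Proof. by move/(sub_wball e x)/subsetP; apply. Qed.

Lemma wball_trans e r s x y z :
  y \in wball e r x -> z \in wball e s y -> z \in wball e (r + s) x.
Proof.
move=> yb; elim: s z => [|s IH] z; first by rewrite inE addn0 => /eqP->.
rewrite addnS => /wballSP[/IH zb|[w /IH wb ewz]]; apply/wballSP; first by left.
by right; exists w.
Qed.

Lemma wball_edge e x y : e x y -> y \in wball e 1 x.
Proof. by move=> exy; apply/wballSP; right; exists x; rewrite // inE. Qed.

Lemma wball_sym e r x y : symmetric e -> (y \in wball e r x) = (x \in wball e r y).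
Proof.
move=> es; suff H u v : u \in wball e r v -> v \in wball e r u by apply/idP/idP; apply: H.
elim: r u v => [|r IH] u v; first by rewrite !inE eq_sym.
case/wballSP=> [/IH|[w /IH wb ewu]]; first exact: wball_le.
by rewrite -add1n; apply: wball_trans wb; apply: wball_edge; rewrite es.
Qed.

Lemma mem_wballP e r x y :
  reflect (exists p, [/\ path e x p, last x p = y & (size p <= r)%N])
          (y \in wball e r x).
Proof.
apply: (iffP idP).
  elim: r y => [|r IH] y; first by rewrite inE => /eqP->; exists [::].
  case/wballSP=> [/IH[p [xp lp sp]]|[z /IH[p [xp lp sp]] ezy]].
    by exists p; split=> //; apply: leqW.
  exists (rcons p y); split; first by rewrite rcons_path xp lp.
    by rewrite last_rcons.
  by rewrite size_rcons.
case=> p [xp <- sp]; apply: wball_le sp _.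
elim/last_ind: p xp => [|p z IH]; first by rewrite inE.
rewrite rcons_path last_rcons size_rcons => /andP[xp ez].
by apply/wballSP; right; exists (last x p); rewrite ?IH.
Qed.

(** The infimum defining a distance is attained or infinite, the lengths of
    walks being natural numbers; so a bound on the diameter is a statement
    about balls. *)
Lemma diameter_le (R : realType) e r :
  (diameter R e <= r%:R%:E)%E <-> forall x y, y \in wball e r x.
Proof.
split=> [dr x y|br].
  apply/negPn/negP => yb.
  have : (distance R e x y <= r%:R%:E)%E.
    by apply: le_trans dr; apply: ereal_sup_ubound; exists (x, y).
  apply/negP; rewrite -ltNge; apply: (@lt_le_trans _ _ (r.+1%:R%:E)).
    by rewrite lte_fin ltr_nat.
  apply: le_ereal_inf_tmp => _ [p [xp lp] <-]; rewrite lee_fin ler_nat ltnNge.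
  by apply/negP => sp; case/mem_wballP: yb; exists p.
apply: ge_ereal_sup => _ [[x y] _ <-] /=.
have /mem_wballP[p [xp lp sp]] := br x y.
apply: (@le_trans _ _ (size p)%:R%:E); last by rewrite lee_fin ler_nat.
by apply: ereal_inf_lbound; exists p.
Qed.

Lemma card_wball e r x D :
  (forall y, (#|[set z | e y z]%SET| < D)%N) -> (#|wball e r x| <= D ^ r)%N.
Proof.
move=> dD; elim: r => [|r IH]; first by rewrite cards1 expn0.
have sub : wball e r.+1 x \subset
    (\bigcup_(y in wball e r x) (y |: [set z | e y z]))%SET.
  apply/subsetP => z /wballSP[zb|[y yb eyz]]; apply/bigcupP.
    by exists z => //; rewrite !inE eqxx.
  by exists y => //; rewrite !inE eyz orbT.
apply: leq_trans (subset_leq_card sub) _.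
apply: leq_trans (card_bigcup_le _ _) _.
apply: (@leq_trans (\sum_(y in wball e r x) D)).
  apply: leq_sum => y _; rewrite cardsU1; apply: leq_trans (dD y).
  by case: (_ \notin _); rewrite ?leqnSn.
by rewrite sum_nat_const expnSr leq_mul2r IH orbT.
Qed.

Lemma wball_mono e e' r x : (forall u v, e u v -> e' u v) ->
  wball e r x \subset wball e' r x.
Proof.
move=> ee'; elim: r => // r IH; apply/subsetP => z /wballSP[zb|[y yb eyz]].
  by apply/wballSP; left; apply: (subsetP IH).
by apply/wballSP; right; exists y; [apply: (subsetP IH)|apply: ee'].
Qed.

(** Adding the edge [pq] to a graph: follow a walk from [x] in the larger graph;
    each time it crosses [pq] it restarts from an end of that edge, and the first
    time it does so it gets to the edge by an old walk. *)
Lemma wball_add_edge e e' p q r x z :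
  (forall u v, e' u v -> [|| e u v, (u == p) && (v == q) | (u == q) && (v == p)]) ->
  z \in wball e' r x -> z \in wball e r x \/ exists i j, [/\ (i + j < r)%N &
    p \in wball e i x /\ z \in wball e j q \/ q \in wball e i x /\ z \in wball e j p].
Proof.
move=> ee'; elim: r z => [|r IH] z; first by left.
have mono i j : (i + j < r)%N -> (i + j < r.+1)%N by move/leqW.
have inc z' : z' \in wball e r x -> z' \in wball e r.+1 x by apply: wball_le.
case/wballSP=> [/IH[zb|[i [j [ij H]]]]|[y /IH yb /ee']].
- by left; apply: inc.
- by right; exists i, j; split=> //; apply: mono.
case/or3P=> [eyz|/andP[/eqP yE /eqP zE]|/andP[/eqP yE /eqP zE]].
- case: yb => [yb|[i [j [ij H]]]]; first by left; apply/wballSP; right; exists y.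
  right; exists i, j.+1; split; first by rewrite addnS ltnS.
  by case: H => -[Hx Hz]; [left|right]; split=> //; apply/wballSP; right; exists y.
- subst y z; case: yb => [yb|[i [j [ij [[Hx Hz]|[Hx Hz]]]]]].
  + by right; exists r, 0; rewrite addn0; split=> //; left; rewrite wball_center.
  + right; exists i, 0; rewrite addn0; split; last by left; rewrite wball_center.
    by apply: leqW; apply: leq_ltn_trans ij; apply: leq_addr.
  + left; apply: wball_le Hx.
    by apply: ltnW; apply: leqW; apply: leq_ltn_trans ij; apply: leq_addr.
subst y z; case: yb => [yb|[i [j [ij [[Hx Hz]|[Hx Hz]]]]]].
+ by right; exists r, 0; rewrite addn0; split=> //; right; rewrite wball_center.
+ left; apply: wball_le Hx.
  by apply: ltnW; apply: leqW; apply: leq_ltn_trans ij; apply: leq_addr.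
right; exists i, 0; rewrite addn0; split; last by right; rewrite wball_center.
by apply: leqW; apply: leq_ltn_trans ij; apply: leq_addr.
Qed.

End Balls.

(** * Stars and degrees in the complete graph *)

Local Notation adj := (@Defs.adjacent _).

Lemma exists_subset_card (T : finType) (W U : {set T}) k :
  W \subset U -> (#|W| <= k <= #|U|)%N ->
  exists m : {set T}, [/\ W \subset m, m \subset U & #|m| = k].
Proof.
move=> WU /andP[Wk]; rewrite -(subnKC Wk); elim: (k - #|W|)%N => [|j IH] kU.
  by exists W; rewrite addn0.
have [|m [Wm mU mk]] := IH; first by apply: leq_trans kU; rewrite addnS.
have /subsetPn[z zU zm] : ~~ (U \subset m).
  by apply: contraL kU => /subset_leq_card; rewrite -ltnNge mk addnS ltnS.
exists (z |: m)%SET; split; first exact: subset_trans Wm (subsetUr _ _).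
  by rewrite subUset sub1set zU.
by rewrite cardsU1 zm mk addnS.
Qed.

Section CompleteGraph.
Variable n : nat.
Implicit Types (E M B m : {set {set 'I_n}}) (v x y : 'I_n).

Definition star v : {set {set 'I_n}} := [set e in complete_edges n | v \in e]%SET.

Lemma adjacent_sym E : symmetric (adj E).
Proof. by move=> x y; rewrite /Defs.adjacent finset.setUC. Qed.

Lemma adjacent_neq E x y : E \subset complete_edges n -> adj E x y -> x != y.
Proof. by move=> /subsetP sE /sE; rewrite inE cards2; case: (x != y). Qed.

Lemma set2_star x y : x != y -> [set x; y]%SET \in star x.
Proof. by move=> xy; rewrite !inE cards2 xy eqxx. Qed.

Lemma card_star_cap E v :
  E \subset complete_edges n -> #|(E :&: star v)%SET| = #|[set z | adj E v z]%SET|.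
Proof.
move=> sE; suff -> : (E :&: star v)%SET =
    [set [set v; z]%SET | z in [set z | adj E v z]%SET]%SET.
  apply: card_in_imset => z1 z2; rewrite !inE => /(adjacent_neq sE) vz1 _.
  move=> /setP/(_ z1); rewrite !inE eqxx orbT eq_sym (negPf vz1) /= => /esym/eqP.
  by [].
apply/setP => e; apply/setIP/imsetP => [[eE]|[z]].
  rewrite inE => /andP[]; rewrite inE => /cards2P[x [y [xy eD]]]; subst e.
  rewrite !inE => /orP[]/eqP ->; [exists y|exists x] => //; rewrite ?inE //.
    by rewrite /Defs.adjacent finset.setUC.
  by rewrite finset.setUC.
rewrite inE => vz ->; split=> //; apply: set2_star; exact: adjacent_neq vz.
Qed.

Lemma card_star v : #|star v| = n.-1.
Proof.
have -> : star v = (complete_edges n :&: star v)%SET.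
  by apply/setP => e; rewrite !inE; case: (_ == _).
rewrite card_star_cap //; have -> : [set z | adj (complete_edges n) v z]%SET = [set~ v]%SET.
  by apply/setP => z; rewrite !inE /Defs.adjacent inE cards2 [v == z]eq_sym; case: (z == v).
by rewrite cardsC1 card_ord.
Qed.

Lemma sum_star m : m \subset complete_edges n ->
  (\sum_v #|(m :&: star v)%SET| = 2 * #|m|)%N.
Proof.
move=> sm; under eq_bigr do rewrite -sum1_card; rewrite (exchange_big_dep (mem m)) /=; last first.
  by move=> v e _; rewrite inE => /andP[].
rewrite mulnC -sum_nat_const; apply: eq_bigr => e em.
have := subsetP sm e em; rewrite inE => /eqP <-; rewrite -sum1_card.
by apply: eq_bigl => v; rewrite !inE em; have := subsetP sm e em; rewrite inE => ->.
Qed.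

Lemma maker_wins_wball (R : realType) d (h : history {set 'I_n}) :
  maker_wins R d h <-> forall x y, y \in wball (adj (claimed_by Maker h)) d x.
Proof. exact: diameter_le. Qed.

End CompleteGraph.

(** * Bounding the degrees in Maker's graph *)

Section DegreeGame.
Variables (n r a : nat).
Implicit Types (M B m : {set {set 'I_n}}) (v : 'I_n).

Definition open_edges M B : {set {set 'I_n}} := (complete_edges n :\: (M :|: B))%SET.

(** What results if Breaker answers each edge of Maker at [v] by [r] edges at [v]:
    all his answers together are fewer than [n], and the last turn of Maker adds at
    most [a] edges. *)
Definition degree_bound M := forall v, (r * #|(M :&: star v)%SET| <= n + r * a)%N.

(** The state that Breaker restores in each of his turns; a vertex with no
    unclaimed edge left needs no further care. *)
Definition degree_balanced M B :=
  degree_bound M /\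
  forall v, (open_edges M B :&: star v)%SET = set0 \/
            (r * #|(M :&: star v)%SET| <= #|(B :&: star v)%SET|)%N.

(** The number of edges at [v] that Breaker has to claim at once to restore the
    balance there. *)
Definition degree_debt M B v :=
  minn #|(open_edges M B :&: star v)%SET|
       (r * #|(M :&: star v)%SET| - #|(B :&: star v)%SET|).

Definition degree_payable M B :=
  degree_bound M /\ (\sum_v degree_debt M B v <= 2 * (r * a))%N.

(** A turn of Maker creates a debt only at the ends of its at most [a] edges, [r]
    for each end of each edge. A vertex whose degree goes up still had an
    unclaimed edge, hence was balanced, and this bounds its degree. *)
Lemma balanced_maker_move M B m : degree_balanced M B ->
  m \subset open_edges M B -> (#|m| <= a)%N -> degree_payable (M :|: m)%SET B.
Proof.
move=> [dM bal] sm ma.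
have mE : m \subset complete_edges n by apply: subset_trans sm (subsetDl _ _).
have deg v : (#|((M :|: m) :&: star v)%SET| <=
              #|(M :&: star v)%SET| + #|(m :&: star v)%SET|)%N.
  by rewrite setIUl; apply: (leq_card_setU _ _).1.
have touched v : (open_edges M B :&: star v)%SET = set0 -> (m :&: star v)%SET = set0.
  move=> no_open; apply/eqP; rewrite -subset0 -no_open; exact: setSI.
have starn v : (#|(B :&: star v)%SET| <= n)%N.
  by apply: leq_trans (subset_leq_card (subsetIr _ _)) _; rewrite card_star leq_pred.
split=> [v|].
  case: (bal v) => [/touched m0|rB].
    by apply: leq_trans (dM v); rewrite leq_mul2l setIUl m0 setU0 leqnn orbT.
  apply: (@leq_trans (r * (#|(M :&: star v)%SET| + #|(m :&: star v)%SET|))).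
    by rewrite leq_mul2l deg orbT.
  rewrite mulnDr leq_add //; first exact: leq_trans rB (starn v).
  rewrite leq_mul2l (leq_trans _ ma) ?orbT //; apply: subset_leq_card; exact: subsetIl.
apply: (@leq_trans (\sum_v r * #|(m :&: star v)%SET|)); last first.
  by rewrite -big_distrr /= sum_star // mulnCA leq_mul2l leq_mul2l ma !orbT.
apply: leq_sum => v _; rewrite /degree_debt.
case: (bal v) => [no_open|rB].
  rewrite (_ : (_ :&: star v)%SET = set0) ?cards0 ?min0n //.
  apply/eqP; rewrite -subset0 -no_open; apply: setSI; apply: setDS; apply: setSU.
  exact: subsetUl.
apply: leq_trans (geq_minr _ _) _; rewrite leq_subLR; apply: leq_trans (leq_add rB (leqnn _)).
by rewrite -mulnDr leq_mul2l deg orbT.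
Qed.

(** The prescribed edges [W] are stated separately from the move that contains
    them, because Breaker may have other edges to claim in the same turn and has
    to claim exactly his quota. *)
Lemma payable_breaker_move M B : degree_payable M B ->
  exists W : {set {set 'I_n}}, [/\ W \subset open_edges M B, (#|W| <= 2 * (r * a))%N &
    forall m, W \subset m -> m \subset open_edges M B -> degree_balanced M (B :|: m)%SET].
Proof.
move=> [dM debt].
have ex v : exists W : {set {set 'I_n}}, [/\ W \subset (open_edges M B :&: star v)%SET &
    #|W| = degree_debt M B v].
  have [|m [_ sm cm]] := @exists_subset_card _ set0 (open_edges M B :&: star v)%SET
    (degree_debt M B v) (sub0set _).
    by rewrite cards0 geq_minl.
  by exists m.
have [W WP] := choice ex.
exists (\bigcup_v W v)%SET; split.
- by apply/bigcupsP => v _; case: (WP v) => sW _; apply: subset_trans sW (subsetIl _ _).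
- apply: leq_trans debt; apply: leq_trans (card_bigcup_le _ _) _.
  by apply: leq_sum => v _; case: (WP v) => _ ->.
move=> m Wm sm; split=> // v.
have Wv : W v \subset m by apply: subset_trans Wm; apply: (bigcup_sup v).
have [sW cW] := WP v.
have Bm : (#|(B :&: star v)%SET| + #|W v| <= #|((B :|: m) :&: star v)%SET|)%N.
  rewrite setIUl cardsU (_ : (_ :&: (m :&: star v))%SET = set0); last first.
    apply/setP => e; rewrite !inE; apply/negP => /andP[/andP[eB _] /andP[em _]].
    by have := subsetP sm e em; rewrite !inE eB orbT.
  rewrite cards0 subn0 leq_add2l; apply: subset_leq_card; apply/subsetP => e eW.
  rewrite inE (subsetP Wv) //=; by have := subsetP sW e eW; rewrite inE => /andP[].
move: cW; rewrite /degree_debt /minn; case: ifP => _ cW.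
  left; have /eqP WE : W v == (open_edges M B :&: star v)%SET.
    by rewrite eqEcard sW cW leqnn.
  apply/setP => e; rewrite !inE; apply/negP => /andP[/andP[H1 e2] ev].
  move: H1; rewrite !negb_or => /and3P[eM eB em].
  case/negP: em; apply: (subsetP Wv); rewrite WE !inE (negPf eM) (negPf eB) e2 /=.
  by case/andP: ev.
by right; apply: leq_trans Bm; rewrite cW -leq_subLR.
Qed.

End DegreeGame.

Lemma exists_superset_move n a b (h : history {set 'I_n}) (W : {set {set 'I_n}}) :
  to_move h = Breaker -> ~~ game_over (complete_edges n) h ->
  W \subset unclaimed (complete_edges n) h -> (#|W| <= b)%N ->
  exists2 m, legal_move (complete_edges n) a b h m & W \subset m.
Proof.
move=> th gh WU Wb.
have [|m [Wm mU mk]] := @exists_subset_card _ W _ (minn b #|unclaimed (complete_edges n) h|) WU.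
  by rewrite geq_minr andbT leq_min Wb subset_leq_card.
by exists m => //; rewrite /legal_move gh mU mk th /= eqxx.
Qed.

Lemma maker_move_card n a b (h : history {set 'I_n}) m : to_move h = Maker ->
  legal_move (complete_edges n) a b h m ->
  m \subset unclaimed (complete_edges n) h /\ (#|m| <= a)%N.
Proof.
by move=> th /and3P[_ sm /eqP->]; split=> //; rewrite th /= geq_minl.
Qed.

Lemma degree_lt n r a (M : {set {set 'I_n}}) : (0 < r)%N -> M \subset complete_edges n ->
  degree_bound r a M -> forall v, (#|[set z | adj M v z]%SET| < (n %/ r + a).+1)%N.
Proof.
move=> r0 sM dM v; rewrite ltnS -card_star_cap // addnC -leq_subLR leq_divRL //.
by rewrite mulnBl leq_subLR mulnC addnC [(a * r)%N]mulnC; apply: dM.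
Qed.

Lemma degree_balanced0 n r a : degree_balanced r a (set0 : {set {set 'I_n}}) set0.
Proof. by split=> v; rewrite set0I cards0 muln0 //; right. Qed.

(** Bounded degrees alone: a ball of radius [d] is too small to be the whole
    vertex set. *)
Lemma breaker_wins_by_degrees (R : realType) n d a b r :
  (0 < r)%N -> (2 * (r * a) <= b)%N -> ((n %/ r + a).+1 ^ d < n)%N ->
  Breaker_has_winning_strategy R d a b n.
Proof.
move=> r0 rb Dn.
pose inv (h : history {set 'I_n}) :=
  if to_move h then degree_payable r a (claimed_by Maker h) (claimed_by Breaker h)
  else degree_balanced r a (claimed_by Maker h) (claimed_by Breaker h).
apply: (@invariant_wins _ _ _ _ _ _ inv).
- by rewrite /inv /= !claimed_by_nil; apply: degree_balanced0.
- move=> h m lh; rewrite /inv => ih th lm; move: ih.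
  have [mU ma] := maker_move_card th lm.
  rewrite /to_move size_rcons /= -/(to_move h) !claimed_by_rcons th /= setU0 => ih.
  exact: balanced_maker_move.
- move=> h lh; rewrite /inv => ih th gh; move: ih.
  rewrite th => /payable_breaker_move[W [WU Wb WP]].
  have [m lm Wm] := exists_superset_move a th gh WU (leq_trans Wb rb).
  exists m => //; rewrite /to_move size_rcons /= -/(to_move h) !claimed_by_rcons th /= setU0.
  by apply: WP => //; case/and3P: lm.
- move=> h lh ih gh /maker_wins_wball win.
  have dM : degree_bound r a (claimed_by Maker h).
    by move: ih; rewrite /inv; case: (to_move h) => -[].
  have n0 : (0 < n)%N by apply: leq_ltn_trans Dn.
  pose x := Ordinal n0.
  have := card_wball d x (degree_lt r0 (claimed_sub _ lh) dM).
  rewrite (_ : wball _ _ _ = setT) ?cardsT ?card_ord; last by apply/setP => y; rewrite win inE.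
  by rewrite leqNgt Dn.
Qed.

(** * Keeping two vertices apart *)

Section Threats.
Variables (n d : nat).
Implicit Types (M B : {set {set 'I_n}}) (x y : 'I_n).

(** The pairs that, if claimed by Maker, would bring [x] and [y] within distance
    [d]: one end is within [i] of [x] and the other within [d.-1 - i] of [y]. *)
Definition threats M x y : {set {set 'I_n}} :=
  (\bigcup_(i < d) [set [set u; w] | u in wball (adj M) i x, w in wball (adj M) (d.-1 - i) y])%SET.

Lemma threatsP M x y (e : {set 'I_n}) :
  reflect (exists i j u w, [/\ (i + j < d)%N, u \in wball (adj M) i x,
             w \in wball (adj M) j y & e = [set u; w]%SET]) (e \in threats M x y).
Proof.
apply: (iffP bigcupP) => [[i _ /imset2P[u w ub wb ->]]|[i [j [u [w [ij ub wb ->]]]]]].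
  by exists i, (d.-1 - i)%N, u, w; split=> //; have := ltn_ord i; lia.
have id : (i < d)%N by lia.
exists (Ordinal id) => //; apply/imset2P; exists u w => //.
by apply: wball_le wb; rewrite /=; lia.
Qed.

Lemma card_imset2_le (f : 'I_n -> 'I_n -> {set 'I_n}) (A C : {set 'I_n}) :
  (#|(f @2: (A, C))%SET| <= #|A| * #|C|)%N.
Proof. by rewrite curry_imset2X -cardsX; apply: leq_imset_card. Qed.

Lemma eq_set2P (u v p q : 'I_n) : [set u; v]%SET = [set p; q]%SET ->
  (u == p) && (v == q) || (u == q) && (v == p).
Proof.
move/setP => E; have := E u; have := E v; have := E p; have := E q.
rewrite !inE !eqxx ?orbT /=.
rewrite (eq_sym q u) (eq_sym q v) (eq_sym p u) (eq_sym p v).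
by do !case: (_ == _).
Qed.

Lemma adj_add_edge M p q (u v : 'I_n) : adj (M :|: [set [set p; q]])%SET u v ->
  [|| adj M u v, (u == p) && (v == q) | (u == q) && (v == p)].
Proof. by rewrite /Defs.adjacent !inE => /orP[->//|/eqP/eq_set2P ->]; rewrite orbT. Qed.

Lemma sub_adj_wball M m r x :
  wball (adj M) r x \subset wball (adj (M :|: m)%SET) r x.
Proof. by apply: wball_mono => u v; rewrite /Defs.adjacent inE => ->. Qed.

(** A short walk from [x] to [y] which uses the new edge [pq] gives old walks from
    [x] to one end of [pq] and from the other end to [y], whose lengths show that
    [pq] was a threat before. *)
Lemma far_maker_move M p q x y :
  y \notin wball (adj M) d x -> [set p; q]%SET \notin threats M x y ->
  y \notin wball (adj (M :|: [set [set p; q]])%SET) d x.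
Proof.
move=> far nt; apply/negP => /(wball_add_edge (@adj_add_edge M p q)).
case=> [|[i [j [ij H]]]]; first exact/negP.
have as_ := @adjacent_sym n M.
case/negP: nt; apply/threatsP.
case: H => -[H1]; rewrite (wball_sym _ _ _ as_) => H2.
  by exists i, j, p, q.
by exists i, j, q, p; split; rewrite // finset.setUC.
Qed.

End Threats.

(** Only about [D ^ d] threats at distance [d.+2] appear with one new edge [pq],
    although there may be [D ^ d.+1] threats in all: a new threat has an end which
    entered the ball around [x] or [y] through [pq]. That end lies around [p] or
    [q], in a ball whose radius is smaller by one than the radius around [x] or
    [y]. Here [E] stands for the unclaimed edges. *)
Lemma new_threats n d (M E : {set {set 'I_n}}) (p q x y : 'I_n) D :
  [disjoint threats d.+2 M x y & E] ->
  (forall v, (#|[set z | adj (M :|: [set [set p; q]])%SET v z]%SET| < D)%N) ->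
  (#|(threats d.+2 (M :|: [set [set p; q]]) x y :&: E)%SET| <= 4 * d.+1 * D ^ d)%N.
Proof.
set M' := (M :|: _)%SET => dis degD.
pose ends i := (wball (adj M') i p :|: wball (adj M') i q)%SET.
pose F (i : 'I_d.+1) :=
  ([set [set u; w] | u in ends i, w in wball (adj M') (d - i) y] :|:
   [set [set u; w] | u in wball (adj M') (d - i) x, w in ends i])%SET.
have endsP i v z : z \notin wball (adj M) i v -> z \in wball (adj M') i v ->
    (0 < i)%N /\ z \in ends i.-1.
  move=> zn /(wball_add_edge (@adj_add_edge n M p q))[zb|[i' [j [ij H]]]].
    by rewrite zb in zn.
  have ji : (j <= i.-1)%N by lia.
  split; first by lia.
  rewrite inE; apply/orP; case: H => -[_ zj]; [right|left];
    by apply: wball_le ji _; apply: (subsetP (sub_adj_wball _ _ _ _)) zj.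
have sub : (threats d.+2 M' x y :&: E)%SET \subset (\bigcup_i F i)%SET.
  apply/subsetP => e /setIP[/threatsP[i [j [u [w [ij ub wb eE]]]]] eE'].
  case uo : (u \in wball (adj M) i x); last first.
    have [i0 ue] := endsP _ _ _ (negbT uo) ub.
    have id : (i.-1 < d.+1)%N by lia.
    apply/bigcupP; exists (Ordinal id) => //; rewrite inE; apply/orP; left; rewrite eE.
    by apply: imset2_f => //; apply: wball_le wb; rewrite /=; lia.
  case wo : (w \in wball (adj M) j y); last first.
    have [j0 we] := endsP _ _ _ (negbT wo) wb.
    have jd : (j.-1 < d.+1)%N by lia.
    apply/bigcupP; exists (Ordinal jd) => //; rewrite inE; apply/orP; right; rewrite eE.
    by apply: imset2_f => //; apply: wball_le ub; rewrite /=; lia.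
  case/pred0P/(_ e)/negP: dis; apply/andP; split=> //.
  by apply/threatsP; exists i, j, u, w.
have cardb r v : (#|wball (adj M') r v| <= D ^ r)%N by apply: card_wball.
apply: leq_trans (subset_leq_card sub) _; apply: leq_trans (card_bigcup_le _ _) _.
apply: (@leq_trans (\sum_(i < d.+1) 4 * D ^ d)); last first.
  by rewrite sum_nat_const card_ord mulnA [(d.+1 * 4)%N]mulnC.
apply: leq_sum => i _.
have cE : (#|ends i| <= 2 * D ^ i)%N.
  by apply: leq_trans (leq_card_setU _ _).1 _; rewrite mul2n -addnn leq_add.
have DD : (D ^ d = D ^ i * D ^ (d - i))%N by rewrite -expnD subnKC // -ltnS.
have -> : (4 * D ^ d = 2 * D ^ i * D ^ (d - i) + D ^ (d - i) * (2 * D ^ i))%N.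
  by rewrite DD; lia.
apply: leq_trans (leq_card_setU _ _).1 _; apply: leq_add;
  by apply: leq_trans (card_imset2_le _ _ _) _; apply: leq_mul.
Qed.

Lemma wball_outside_edge n (p q v : 'I_n) r :
  v \notin [set p; q]%SET -> wball (adj [set [set p; q]]%SET) r v = [set v]%SET.
Proof.
move=> vn; apply/setP => z; apply/idP/idP; last by rewrite inE => /eqP->; apply: wball_center.
elim: r z => [|r IH] z //; case/wballSP=> [/IH//|[z' /IH]].
rewrite inE => /eqP ->; rewrite /Defs.adjacent !inE => /eqP E.
by case/negP: vn; rewrite -E !inE eqxx.
Qed.

Lemma single_threat n d (p q x y : 'I_n) :
  x \notin [set p; q]%SET -> y \notin [set p; q]%SET ->
  threats d [set [set p; q]]%SET x y \subset [set [set x; y]]%SET.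
Proof.
move=> xn yn; apply/subsetP => e /threatsP[i [j [u [w [_ ub wb ->]]]]].
move: ub wb; rewrite !wball_outside_edge // !inE => /eqP -> /eqP ->; exact: eqxx.
Qed.

Lemma exists_two_outside n (p q : 'I_n) : (3 < n)%N ->
  exists x y, [/\ x != y, x \notin [set p; q]%SET & y \notin [set p; q]%SET].
Proof.
move=> n4; have : (1 < #|~: [set p; q]%SET|)%N.
  have := cardsC [set p; q]%SET; rewrite card_ord cards2; case: (p != q); lia.
case/card_gt1P=> x [y [xs ys xy]]; exists x, y; split=> //.
  by move: xs; rewrite in_setC.
by move: ys; rewrite in_setC.
Qed.

(** Breaker fixes [x] and [y] off the first edge of Maker, and in each turn pays
    his debts at the degrees and claims all the threats. His bias has to be
    compared with [D ^ d] only, although it is distance [d.+2] that he prevents. *)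
Lemma breaker_wins_by_threats (R : realType) n d b r :
  (3 < n)%N -> (0 < r)%N ->
  (2 * r + 4 * d.+1 * (n %/ r + 2) ^ d <= b)%N ->
  Breaker_has_winning_strategy R d.+2 1 b n.
Proof.
move=> n4 r0 rb; set D := (n %/ r + 2)%N in rb.
pose open (h : history {set 'I_n}) := unclaimed (complete_edges n) h.
pose far (M : {set {set 'I_n}}) (x y : 'I_n) := y \notin wball (adj M) d.+2 x.
pose inv (h : history {set 'I_n}) := let M := claimed_by Maker h in
  if to_move h then degree_payable r 1 M (claimed_by Breaker h) /\
     (exists x y, far M x y /\ (#|(threats d.+2 M x y :&: open h)%SET| <= 4 * d.+1 * D ^ d)%N)
  else degree_balanced r 1 M (claimed_by Breaker h) /\
     (h = [::] \/ exists x y, far M x y /\ [disjoint threats d.+2 M x y & open h]).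
have degD (M : {set {set 'I_n}}) : M \subset complete_edges n -> degree_bound r 1 M ->
    forall v, (#|[set z | adj M v z]%SET| < D)%N.
  by move=> sM dM v; have := degree_lt r0 sM dM v; rewrite addn1 /D addn2.
apply: (@invariant_wins _ _ _ _ _ _ inv).
- by rewrite /inv /= !claimed_by_nil; split; [apply: degree_balanced0|left].
- move=> h m lh; rewrite /inv => ih th lm.
  have lhm : legal_play (complete_edges n) 1 b (rcons h m) by apply/legal_play_rcons.
  have := claimed_sub Maker lhm.
  have [mU ma] := maker_move_card th lm.
  have m1 : #|m| = 1%N.
    have /and3P[gh _ /eqP->] := lm; rewrite th /=; apply/minn_idPl.
    by rewrite card_gt0.
  have mC : m \subset complete_edges n by apply: subset_trans mU (subsetDl _ _).
  have /cards1P[e me] : #|m| == 1%N by rewrite m1.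
  have : e \in complete_edges n by apply: (subsetP mC); rewrite me inE.
  rewrite inE => /cards2P[p [q [pq eE]]].
  move: ih; rewrite /open unclaimed_rcons.
  rewrite /to_move size_rcons /= -/(to_move h) !claimed_by_rcons th /= setU0.
  case=> bal ih sMm; have pay := balanced_maker_move bal mU ma.
  split=> //; rewrite me eE in sMm pay *.
  case: ih => [h0|[x [y [fxy dis]]]].
    have [x [y [xy xn yn]]] := exists_two_outside p q n4.
    exists x, y; rewrite h0 claimed_by_nil set0U; split.
      by rewrite /far wball_outside_edge // inE eq_sym.
    apply: leq_trans (_ : 1 <= _)%N; last first.
      by rewrite !muln_gt0 /= expn_gt0 /D addn2.
    rewrite -(cards1 [set x; y]%SET); apply: subset_leq_card.
    by apply: subset_trans (subsetIl _ _) _; apply: single_threat.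
  exists x, y; split.
    apply: far_maker_move => //; apply/negP => nt.
    case/pred0P/(_ [set p; q]%SET)/negP: dis; apply/andP; split=> //.
    by apply: (subsetP mU); rewrite me eE inE.
  apply: leq_trans (new_threats dis (degD _ sMm pay.1)).
  by apply: subset_leq_card; apply: setIS; apply: subsetDl.
- move=> h lh; rewrite /inv => ih th gh; move: ih; rewrite th => -[pay [x [y [fxy cT]]]].
  have [W [WU Wb WP]] := payable_breaker_move pay.
  have [||m lm Wm] := @exists_superset_move n 1 b h (W :|: (threats d.+2 (claimed_by Maker h) x y :&: open h))%SET th gh.
  - by rewrite subUset WU subsetIr.
  - apply: leq_trans (leq_card_setU _ _).1 _; apply: leq_trans rb.
    by apply: leq_add => //; rewrite muln1 in Wb.
  have mU : m \subset open h by case/and3P: lm.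
  exists m => //; rewrite /open unclaimed_rcons.
  rewrite /to_move size_rcons /= -/(to_move h) !claimed_by_rcons th /= setU0.
  move: Wm; rewrite subUset => /andP[Wm Tm].
  split; first exact: WP.
  right; exists x, y; split=> //; rewrite -setI_eq0; apply/eqP/setP => e.
  rewrite in_set0 in_setI in_setD; apply/negP => /and3P[eT em eO]; case/negP: em; apply: (subsetP Tm).
  by rewrite in_setI eT.
- move=> h lh ih gh /maker_wins_wball win.
  have : exists x y, far (claimed_by Maker h) x y.
    move: ih; rewrite /inv; case: (to_move h) => -[_] => [[x [y [fxy _]]]|].
      by exists x, y.
    case=> [h0|[x [y [fxy _]]]]; last by exists x, y.
    move: gh; rewrite h0 /game_over /unclaimed !claimed_by_nil setU0 setD0 => /eqP cE.
    have n1 : (1 < n)%N by lia.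
    have n0 : (0 < n)%N by lia.
    (* The board is not empty, so the game cannot be over before the first move. *)
    have := set2_star (_ : Ordinal n0 != Ordinal n1); rewrite /star inE cE inE.
    by move/(_ isT).
  by case=> x [y /negP[]]; apply: win.
Qed.

(** * Breaker's biases *)

Lemma powR_root (R : realType) (t : R) k : 0 <= t -> (0 < k)%N ->
  let Y := t `^ k%:R^-1 in Y ^+ k = t /\ t `^ (1 - k%:R^-1) = Y ^+ k.-1.
Proof.
move=> t0 k0 Y; have k1 : (k%:R : R) != 0 by rewrite pnatr_eq0 -lt0n.
split; rewrite -powR_mulrn ?powR_ge0 // -powRrM; first by rewrite mulVf // powRr1.
congr powR; rewrite -subn1 natrB // mulrBr mulVf // mulr1; ring.
Qed.

Lemma natr_div_le (R : realType) n r (s : R) : 0 < s -> s <= r%:R ->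
  ((n %/ r)%:R : R) <= n%:R / s.
Proof.
move=> s0 sr; rewrite ler_pdivlMr //; apply: (@le_trans _ _ ((n %/ r)%:R * r%:R)).
  exact: ler_wpM2l.
by rewrite -natrM ler_nat leq_divM.
Qed.

Lemma truncnS_bounds (R : realType) (s : R) : 0 <= s ->
  s <= (Num.truncn s).+1%:R <= s + 1.
Proof.
move=> s0; have /andP[h1 h2] := truncn_itv s0.
by rewrite (ltW h2) /= -natr1 lerD2r.
Qed.

Lemma root_large (R : realType) (Y : R) k C n :
  (0 < k)%N -> 0 <= Y -> Y ^+ k = n%:R -> (C ^ k <= n)%N -> C%:R <= Y.
Proof.
move=> k0 Y0 Yn Cn; rewrite leNgt; apply/negP => YC.
have : Y ^+ k < C%:R ^+ k by rewrite ltrXn2r // -lt0n.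
by rewrite Yn -natrX ltr_nat ltnNge Cn.
Qed.

(** With [Y] the [d]-th root of [n], answering each end of each edge of Maker by
    [4 Y^(d-1)] edges, within a bias of [(10 a + 1) Y^(d-1)], keeps all degrees
    at most [Y / 4 + a]; so [Y] exceeds each degree by more than one once
    [2 a + 4 <= Y]. *)
Lemma breaker_wins_small_bias (R : realType) a d n :
  (0 < d)%N -> ((2 * a + 4) ^ d <= n)%N ->
  Breaker_has_winning_strategy R d a
    (Num.truncn ((10 * a + 1)%:R * n%:R `^ (1 - d%:R^-1) : R)) n.
Proof.
move=> d0 nl; have := powR_root (ler0n R n) d0.
set Y := n%:R `^ d%:R^-1 => -[Yn ->].
have YC : (2 * a + 4)%:R <= Y := root_large d0 (powR_ge0 _ _) Yn nl.
have Y1 : 1 <= Y by apply: le_trans YC; rewrite ler1n addn_gt0 orbT.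
have Y0 : 0 < Y by apply: lt_le_trans Y1.
set P := Y ^+ d.-1; have P1 : 1 <= P by apply: exprn_ege1.
have nP : n%:R = Y * P by rewrite -Yn /P -exprS prednK.
have P4 : 0 <= 4 * P by lra.
have /andP[r1 r2] := truncnS_bounds P4; set r := (Num.truncn (4 * P)).+1 in r1 r2 *.
apply: (@breaker_wins_by_degrees R n d a _ r) => //.
  rewrite truncn_ge_nat; last by apply: mulr_ge0 => //; lra.
  have ra : a%:R * r%:R <= a%:R * (5 * P) by apply: ler_wpM2l => //; lra.
  by rewrite natrD !natrM; lra.
rewrite -(ltr_nat R) natrX -Yn ltrXn2r // ?ler0n // -?lt0n //.
rewrite -natr1 natrD; have := @natr_div_le R n r (4 * P).
rewrite nP => /(_ _ r1) H.
have {}H : (n %/ r)%:R <= Y / 4.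
  apply: le_trans (H _) _; first by lra.
  rewrite le_eqVlt; apply/orP; left; apply/eqP; field; lra.
rewrite natrD natrM in YC; lra.
Qed.

(** Here [Y] is the [e.+1]-th root of [n] and all degrees are at most [Y / 4 + 1].
    Of the bias [(4 e + 14) Y^e], at most [10 Y^e] pays the debts at the degrees,
    and the rest covers the [4 (e + 1) Y^e] new threats. *)
Lemma breaker_wins_single_bias (R : realType) e n :
  (0 < e)%N -> (4 ^ e.+1 <= n)%N ->
  Breaker_has_winning_strategy R e.+2 1
    (Num.truncn ((4 * e + 14)%:R * n%:R `^ (1 - (e.+2%:R - 1)^-1) : R)) n.
Proof.
move=> e0 nl; have -> : (e.+2%:R - 1 : R) = e.+1%:R by rewrite -natr1 addrK.
have := @powR_root R n%:R e.+1 (ler0n R n) isT.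
set Y := n%:R `^ e.+1%:R^-1 => -[Yn ->].
have YC : 4%:R <= Y := root_large (isT : 0 < e.+1)%N (powR_ge0 _ _) Yn nl.
have Y1 : 1 <= Y by lra.
have Y0 : 0 < Y by lra.
rewrite /=; set P := Y ^+ e; have P1 : 1 <= P by apply: exprn_ege1.
have nP : n%:R = Y * P by rewrite -Yn /P -exprS.
have P4 : 0 <= 4 * P by lra.
have /andP[r1 r2] := truncnS_bounds P4; set r := (Num.truncn (4 * P)).+1 in r1 r2 *.
have D_le : (n %/ r + 2)%:R <= Y.
  rewrite natrD; have := @natr_div_le R n r (4 * P).
  rewrite nP => /(_ _ r1) H.
  have {}H : (n %/ r)%:R <= Y / 4.
    apply: le_trans (H _) _; first by lra.
    rewrite le_eqVlt; apply/orP; left; apply/eqP; field; lra.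
  lra.
apply: (@breaker_wins_by_threats R n e _ r) => //.
  apply: leq_trans nl; rewrite expnS; have := expn_gt0 4 e; lia.
rewrite truncn_ge_nat; last by apply: mulr_ge0 => //; lra.
move: (n %/ r + 2)%N D_le => D D_le.
have DP : D%:R ^+ e <= P by rewrite /P lerXn2r // nnegrE ?ler0n // ltW.
have DP4 : (4 * e.+1%:R) * D%:R ^+ e <= (4 * e.+1%:R) * P.
  by apply: ler_wpM2l => //; apply: mulr_ge0.
have -> : (2 * r + 4 * e.+1 * D ^ e)%:R = 2 * r%:R + 4 * e.+1%:R * D%:R ^+ e :> R.
  by rewrite natrD !natrM natrX.
have -> : (4 * e + 14)%:R = 4 * e%:R + 14 :> R by rewrite natrD natrM.
by move: DP4; rewrite -![e.+1%:R]natr1; lra.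
Qed.

(** * The potential strategy *)

Lemma expR_le1D2x (R : realType) (y : R) : 0 <= y <= 2^-1 -> expR y <= 1 + 2 * y.
Proof.
move=> /andP[y0 y1]; have := expR_ge1Dx (- y); rewrite expRN => H.
have e0 := expR_gt0 y.
have : (1 - y) * expR y <= 1 by rewrite -ler_pdivlMr // mul1r.
nra.
Qed.

(** Each target [A i] carries a weight that drops by the factor [1 - theta i] with
    each of its edges taken by Maker, and grows by the factor
    [expR (theta i / (2 beta))] with each edge taken by Breaker. For [theta i = 1]
    only the targets that Maker has not met count, and the final weight tells
    whether [A i] was met; for smaller [theta i] it controls how many edges of
    [A i] are Maker's. *)
Section Potential.
Variables (T : finType) (board : {set T}) (b : nat).
Variables (R : realType) (beta : R) (I : finType).
Variables (A : I -> {set T}) (w theta : I -> R).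
Hypothesis beta_gt0 : 0 < beta.
Hypothesis b_le_beta : b%:R <= beta.
Hypothesis w_ge0 : forall i, 0 <= w i.
Hypothesis theta01 : forall i, 0 <= theta i <= 1.
Implicit Types (M B m : {set T}) (e f : T).

Definition weight M B i : R :=
  w i * (1 - theta i) ^+ #|(A i :&: M)%SET|
      * expR (theta i / 2 * (#|(A i :&: B)%SET|%:R / beta)).

Definition potential M B : R := \sum_i weight M B i.

Definition danger M B e : R := \sum_(i | e \in A i) theta i * weight M B i.

Lemma weight_ge0 M B i : 0 <= weight M B i.
Proof.
have /andP[_ t1] := theta01 i.
by rewrite !mulr_ge0 // ?expR_ge0 // exprn_ge0 // subr_ge0.
Qed.

Lemma weight_maker M B e i : e \notin M ->
  weight (e |: M)%SET B i = weight M B i * (if e \in A i then 1 - theta i else 1).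
Proof.
move=> eM; rewrite /weight; case: ifP => eA.
  rewrite (_ : (A i :&: (e |: M))%SET = (e |: (A i :&: M))%SET); last first.
    by apply/setP => z; rewrite !inE; case: eqP => // ->; rewrite eA.
  by rewrite cardsU1 !inE (negPf eM) andbF /= exprS; ring.
rewrite (_ : (A i :&: (e |: M))%SET = (A i :&: M)%SET) ?mulr1 //.
by apply/setP => z; rewrite !inE; case: eqP => // ->; rewrite eA.
Qed.

(** The condition [b <= beta] keeps the exponent in the range where the
    exponential lies below a line, so that the growth caused by the edges of one
    turn is at most additive in these edges. *)
Lemma weight_breaker M B m i : (#|m| <= b)%N ->
  weight M (B :|: m)%SET i <= weight M B i * (1 + theta i * (#|(A i :&: m)%SET|%:R / beta)).
Proof.
move=> mb; have /andP[t0 t1] := theta01 i; rewrite /weight -mulrA -[X in _ <= X]mulrA.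
rewrite -[X in _ <= X]mulrA.
apply: ler_wpM2l => //; apply: ler_wpM2l; first by rewrite exprn_ge0 // subr_ge0.
set x := _ / beta; set y := #|(A i :&: m)%SET|%:R / beta.
set z := #|(A i :&: B)%SET|%:R / beta.
have xy : x <= z + y.
  rewrite /x /y /z -mulrDl ler_pM2r ?invr_gt0 // -natrD ler_nat setIUr.
  exact: (leq_card_setU _ _).1.
have y0 : 0 <= y by rewrite divr_ge0 // ltW.
have y1 : y <= 1.
  rewrite ler_pdivrMr // mul1r; apply: le_trans b_le_beta.
  by rewrite ler_nat (leq_trans _ mb) // subset_leq_card // subsetIr.
apply: (@le_trans _ _ (expR (theta i / 2 * z) * expR (theta i / 2 * y))).
  rewrite -expRD ler_expR -mulrDr; apply: ler_wpM2l => //; lra.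
apply: ler_wpM2l; first exact: expR_ge0.
apply: le_trans (expR_le1D2x _) _; last by lra.
apply/andP; split; nra.
Qed.

Lemma potential_maker M B e : e \notin M ->
  potential (e |: M)%SET B = potential M B - danger M B e.
Proof.
move=> eM; rewrite /potential /danger [X in _ - X]big_mkcond /= -sumrB.
by apply: eq_bigr => i _; rewrite weight_maker //; case: ifP => _; ring.
Qed.

Lemma danger_maker M B e f : e \notin M -> danger (e |: M)%SET B f <= danger M B f.
Proof.
move=> eM; apply: ler_sum => i _; have /andP[t0 t1] := theta01 i.
apply: ler_wpM2l => //; rewrite weight_maker // ler_piMr ?weight_ge0 //.
by case: ifP => _; lra.
Qed.

Lemma potential_breaker M B m : (#|m| <= b)%N ->
  potential M (B :|: m)%SET <= potential M B + (\sum_(f in m) danger M B f) / beta.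
Proof.
move=> mb; rewrite /danger (exchange_big_dep predT) //= mulr_suml -big_split /=.
apply: ler_sum => i _; apply: le_trans (weight_breaker _ _ _ mb) _.
rewrite sumr_const (_ : #|_| = #|(A i :&: m)%SET|); last first.
  by apply: eq_card => z; rewrite !inE andbC.
by rewrite -mulr_natr; lra.
Qed.

(** Maker always takes the edge of largest danger. This lowers the potential by
    the danger of that edge, which bounds the danger of each of the at most [b]
    edges of the reply, so that the reply cannot restore more than was lost. *)
Lemma potential_wins (win : history T -> Prop) :
  (forall h, legal_play board 1 b h -> game_over board h ->
     potential (claimed_by Maker h) (claimed_by Breaker h) <= potential set0 set0 ->
     win h) ->
  exists s, winning_strategy board 1 b Maker win s.
Proof.
move=> winP; set P0 := potential set0 set0 in winP.
pose pot h := potential (claimed_by Maker h) (claimed_by Breaker h).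
pose dan h := danger (claimed_by Maker h) (claimed_by Breaker h).
pose inv h := pot h <= P0 /\ (to_move h = Breaker ->
  forall f, f \in unclaimed board h -> pot h + dan h f <= P0).
apply: (@invariant_wins _ _ _ _ _ _ inv).
- by split=> //; rewrite /pot !claimed_by_nil.
- move=> h m lh [potP danP] th /and3P[_ sm /eqP cm].
  split; last by rewrite /to_move size_rcons /= -/(to_move h) th.
  have mb : (#|m| <= b)%N by rewrite cm th /= geq_minl.
  rewrite /pot !claimed_by_rcons th /= setU0.
  apply: le_trans (potential_breaker _ _ mb) _.
  have Hsum : \sum_(f in m) dan h f <= b%:R * (P0 - pot h).
    apply: (@le_trans _ _ (\sum_(f in m) (P0 - pot h))).
      apply: ler_sum => f fm; rewrite lerBrDl; apply: danP => //.
      exact: (subsetP sm).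
    rewrite sumr_const -[X in X <= _]mulr_natl; apply: ler_wpM2r; first by rewrite subr_ge0.
    by rewrite ler_nat.
  have : (\sum_(f in m) dan h f) / beta <= P0 - pot h.
    rewrite ler_pdivrMr // mulrC; apply: le_trans Hsum _.
    by apply: ler_wpM2r => //; rewrite subr_ge0.
  by rewrite /dan /pot; lra.
- move=> h lh [potP _] th gh.
  have /set0Pn[e0 e0U] : unclaimed board h != set0 by [].
  have [e eU emax] := @arg_maxP _ R _ e0 (mem (unclaimed board h)) (dan h) e0U.
  have {}eU : e \in unclaimed board h by exact: eU.
  have eM : e \notin claimed_by Maker h.
    by move: eU; rewrite /= !inE negb_or => /andP[/andP[]].
  have pE : pot (rcons h [set e]%SET) = pot h - dan h e.
    rewrite /pot !claimed_by_rcons th /= setU0 finset.setUC; exact: potential_maker.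
  have dan0 : 0 <= dan h e.
    by apply: sumr_ge0 => i _; rewrite mulr_ge0 ?weight_ge0 //; case/andP: (theta01 i).
  exists [set e]%SET.
    rewrite /legal_move gh sub1set eU /= cards1 th /=; apply/eqP/esym/minn_idPl.
    by rewrite card_gt0.
  split; first by rewrite pE; lra.
  move=> _ f; rewrite unclaimed_rcons => /setDP[fU _].
  have df : dan (rcons h [set e]%SET) f <= dan h f.
    rewrite /dan !claimed_by_rcons th /= setU0 finset.setUC; exact: danger_maker.
  by have fe : dan h f <= dan h e := emax _ fU; rewrite pE; move: df fe; lra.
- by move=> h lh [potP _] gh; apply: winP.
Qed.

End Potential.

(** * Edges between large sets *)

Section Cross.
Variable n : nat.
Implicit Types (S U Q : {set 'I_n}) (M : {set {set 'I_n}}).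

Definition cross S U : {set {set 'I_n}} := [set [set u; v] | u in S, v in U]%SET.

Lemma cross_sub S U : [disjoint S & U] -> cross S U \subset complete_edges n.
Proof.
move=> dSU; apply/subsetP => e /imset2P[u v uS vU ->]; rewrite inE cards2.
by case: (eqVneq u v) => // uv; case/pred0P/(_ u)/negP: dSU; rewrite /= uS uv vU.
Qed.

Lemma card_cross S U : [disjoint S & U] -> #|cross S U| = (#|S| * #|U|)%N.
Proof.
move=> dSU; rewrite /cross curry_imset2X -cardsX; apply: card_in_imset => -[u v] [u' v'].
rewrite !inE /= => /andP[uS vU] /andP[uS' vU'] /eq_set2P.
case/orP=> /andP[/eqP u1 /eqP v1]; first by rewrite u1 v1.
by case/pred0P/(_ u)/negP: dSU; rewrite /= uS u1 vU'.
Qed.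

Lemma sum_expr_card (K : comNzRingType) (q : K) :
  \sum_(S : {set 'I_n}) q ^+ #|S| = (1 + q) ^+ n.
Proof.
have <- : \prod_(i < n) (q + 1) = (1 + q) ^+ n by rewrite prodr_const card_ord addrC.
rewrite bigA_distr; apply: eq_big => // S _.
rewrite -big_mkcond /= prodr_const; by [].
Qed.

End Cross.

Section MakerPotential.
Variables (R : realType) (n : nat) (beta L : R).
Hypothesis beta_gt0 : 0 < beta.
Hypothesis n12 : (12 <= n)%N.
Hypothesis nL : n%:R = expR L.
Implicit Types (S U Q : {set 'I_n}) (M B : {set {set 'I_n}}).

(** The sets of edges that Maker must meet join [S] either to [Q] or to the
    complement of [Q]. In the second case [Q] is small, and it is [Q] that has to
    be counted: there are far fewer small sets than large ones. *)
Definition far_end (c : bool) Q := if c then Q else (~: Q)%SET.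

(** A bundle of edges between [S] and [U] has initial weight [expR (- decay S U)],
    which makes its final weight [1] if Breaker owns it all. *)
Definition decay S U : R := #|S|%:R * #|U|%:R / (2 * beta).

(** The pairs that can be treated at once. With [n = expR L], the last condition
    bounds the initial weight by [n ^- (2 (|S| + |Q|))], so that the sum over all
    choices of [S] and [Q] stays small. *)
Definition heavy (t : bool * {set 'I_n} * {set 'I_n}) : bool :=
  let: (c, A, Q) := t in
  [&& A != set0, [disjoint A & far_end c Q] &
      2 * (#|A|%:R + #|Q|%:R) * L <= decay A (far_end c Q)].

Definition target := ('I_n + bool * {set 'I_n} * {set 'I_n})%type.

Definition target_edges (t : target) : {set {set 'I_n}} :=
  match t with inl v => star v | inr (c, A, Q) => cross A (far_end c Q) end.

Definition target_weight (t : target) : R :=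
  match t with
  | inl v => (2 * n%:R)^-1
  | inr (c, A, Q) =>
      if heavy (c, A, Q) then expR (- decay A (far_end c Q)) else 0
  end.

(** One edge of a bundle suffices, while a star has to be hit many times. *)
Definition target_theta (t : target) : R := if t is inl _ then 2^-1 else 1.

Let pot := potential beta target_edges target_weight target_theta.

Lemma target_weight_ge0 t : 0 <= target_weight t.
Proof.
case: t => [v|[[c S] Q]] /=; first by rewrite invr_ge0 mulr_ge0.
by case: ifP => _ //; exact: expR_ge0.
Qed.

Lemma target_theta01 t : 0 <= target_theta t <= 1.
Proof. by case: t => [v|p] /=; apply/andP; split; lra. Qed.

(** The stars contribute [1/2]. The bundles contribute at most
    [2 ((1 + q)^n - 1) (1 + q)^n], where [q = n^-2]: expand the two powers as sums
    over the sets [Q] and [S], the empty [S] being excluded. *)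
Lemma initial_potential_lt1 : pot set0 set0 < 1.
Proof.
have n0 : 0 < n%:R :> R by rewrite ltr0n; apply: leq_trans n12.
have n12R : 12 <= n%:R :> R by rewrite (ler_nat R 12 n).
have wE t : weight beta target_edges target_weight target_theta set0 set0 t = target_weight t.
  by rewrite /weight !setI0 cards0 expr0 mul0r mulr0 expR0 !mulr1.
rewrite /pot /potential (eq_bigr _ (fun t _ => wE t)) big_sumType /=.
have -> : \sum_(i < n) (2 * n%:R)^-1 = 2^-1 :> R.
  rewrite sumr_const card_ord -mulr_natl; field; lra.
pose q := expR (- (2 * L)).
have qn : q = (n%:R ^+ 2)^-1.
  by rewrite /q expRN nL -expRM_natl.
have le1 (t : bool * {set 'I_n} * {set 'I_n}) :
    target_weight (inr t) <= (t.1.2 != set0)%:R * q ^+ #|t.1.2| * q ^+ #|t.2|.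
  case: t => -[c S] Q; rewrite [target_weight _]/=; case: ifP => [/and3P[S0 _ H]|_].
    rewrite S0 mul1r -exprD -expRM_natl ler_expR natrD.
    by move: H; rewrite /decay /=; lra.
  by rewrite !mulr_ge0 ?exprn_ge0 ?expR_ge0.
have sumq : \sum_(S : {set 'I_n}) (S != set0)%:R * q ^+ #|S| = (1 + q) ^+ n - 1.
  rewrite -sum_expr_card (bigD1 set0) //= eqxx mul0r add0r.
  rewrite [in RHS](bigD1 set0) //= cards0 expr0 addrC addrK.
  by apply: eq_bigr => S ->; rewrite mul1r.
have pair : \sum_(t : bool * {set 'I_n} * {set 'I_n})
    (t.1.2 != set0)%:R * q ^+ #|t.1.2| * q ^+ #|t.2| = 2 * ((1 + q) ^+ n - 1) * (1 + q) ^+ n.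
  rewrite -(pair_bigA _ (fun (cS : bool * {set 'I_n}) Q => (cS.2 != set0)%:R * q ^+ #|cS.2| * q ^+ #|Q|)) /=.
  under eq_bigr => cS _ do rewrite -big_distrr /= sum_expr_card.
  rewrite -big_distrl /=; congr (_ * _).
  rewrite -(pair_bigA _ (fun (c : bool) S => (S != set0)%:R * q ^+ #|S|)) /=.
  by under eq_bigr do rewrite sumq; rewrite sumr_const card_bool mulr_natl.
set m := (n%:R : R) in n0 n12R qn *.
have mi0 : 0 < m^-1 by rewrite invr_gt0.
have mi1 : m^-1 <= 12^-1 by rewrite lef_pV2 // posrE.
have pow : (1 + q) ^+ n <= 1 + 2 * m^-1.
  apply: (@le_trans _ _ (expR q ^+ n)).
    have q0 : 0 <= q by apply: expR_ge0.
    by rewrite lerXn2r // ?nnegrE ?expR_ge0 //; [lra|apply: expR_ge1Dx].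
  rewrite -expRM_natl -/m qn (_ : m * (m ^+ 2)^-1 = m^-1); last by field; lra.
  by apply: expR_le1D2x; lra.
have pow1 : 1 <= (1 + q) ^+ n by apply: exprn_ege1; have := expR_ge0 (- (2 * L)); rewrite -/q; lra.
have H : \sum_(t : bool * {set 'I_n} * {set 'I_n}) target_weight (inr t) <=
    2 * ((1 + q) ^+ n - 1) * (1 + q) ^+ n.
  by rewrite -pair; apply: ler_sum => t _; apply: le1.
apply: (@le_lt_trans _ _ (2^-1 + 2 * ((1 + q) ^+ n - 1) * (1 + q) ^+ n)).
  by rewrite lerD2l; apply: H.
nra.
Qed.

Section FinalPosition.
Variables M B : {set {set 'I_n}}.
Hypothesis sM : M \subset complete_edges n.
Hypothesis MB : complete_edges n \subset (M :|: B)%SET.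
Hypothesis final : pot M B <= pot set0 set0.

Lemma final_weight_lt1 t :
  weight beta target_edges target_weight target_theta M B t < 1.
Proof.
apply: le_lt_trans initial_potential_lt1; apply: le_trans final.
rewrite /pot /potential (bigD1 t) //= lerDl; apply: sumr_ge0 => i _.
exact: weight_ge0 target_weight_ge0 target_theta01 _ _ _.
Qed.

Lemma heavy_crossed c S Q : heavy (c, S, Q) ->
  exists u v, [/\ u \in S, v \in far_end c Q & adj M u v].
Proof.
move=> hv; have := final_weight_lt1 (inr (c, S, Q)).
have /and3P[_ dS _] := hv.
rewrite /weight /target_weight hv /= subrr mul1r.
case: (eqVneq (cross S (far_end c Q) :&: M)%SET set0) => [E0|/set0Pn[e]]; last first.
  case/setIP=> /imset2P[u v uS vF ->] uvM _; exists u, v; split=> //.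
have -> : (cross S (far_end c Q) :&: B)%SET = cross S (far_end c Q).
  apply/setIidPl/subsetP => e eC.
  have := subsetP MB e (subsetP (cross_sub dS) e eC); rewrite inE => /orP[eM|//].
  by have := in_set0 e; rewrite -E0 inE eC eM.
rewrite E0 cards0 expr0 mulr1 -expRD card_cross // natrM.
rewrite [X in expR X](_ : _ = 0) ?expR0 ?ltxx //.
by rewrite /decay; field; rewrite gt_eqF.
Qed.

(** The star of [v] ends with weight below [1]. Take logarithms, bounding the
    factor [1/2] for each edge of Maker from below by [expR (-1)], and the initial
    weight by [n ^- 2 = expR (- 2 L)]. *)
Lemma final_degree v :
  (n.-1%:R - #|(M :&: star v)%SET|%:R) / (4 * beta) < 2 * L + #|(M :&: star v)%SET|%:R.
Proof.
have n0 : 0 < n%:R :> R by rewrite ltr0n; apply: leq_trans n12.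
have n12R : 12 <= n%:R :> R by rewrite (ler_nat R 12 n).
have := final_weight_lt1 (inl v); rewrite /weight /=.
set D := #|(M :&: star v)%SET|; rewrite [(star v :&: M)%SET]finset.setIC -/D.
have Bc : n.-1%:R - D%:R <= #|(star v :&: B)%SET|%:R :> R.
  rewrite lerBlDl -natrD ler_nat -(card_star v).
  apply: leq_trans (leq_card_setU _ _).1; apply: subset_leq_card; apply/subsetP => e es.
  have eC : e \in complete_edges n by move: es; rewrite inE => /andP[].
  by rewrite in_setU !in_setI es andbT; have := subsetP MB e eC; rewrite in_setU.
clearbody D.
have h2 : expR (-1) <= 2^-1 :> R.
  by rewrite expRN lef_pV2 ?posrE ?expR_gt0 //; have := expR_ge1Dx (1:R); lra.
have hD : expR (- D%:R) <= (1 - 2^-1) ^+ D :> R.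
  rewrite -mulrN1 expRM_natl lerXn2r // ?nnegrE ?expR_ge0 //; lra.
have hn : expR (- (2 * L)) <= (2 * n%:R)^-1.
  rewrite expRN lef_pV2 ?posrE ?expR_gt0 ?mulr_gt0 //.
  by rewrite expRM_natl -nL expr2 ler_pM2r //; rewrite (ler_nat R 2 n) (leq_trans _ n12).
move=> H; rewrite -subr_lt0 -expR_lt1; apply: le_lt_trans H.
set x := (n.-1%:R - D%:R) in Bc *.
have -> : x / (4 * beta) - (2 * L + D%:R) = - (2 * L) + - D%:R + x / (4 * beta) by lra.
rewrite !expRD; apply: ler_pM; rewrite ?mulr_ge0 ?expR_ge0 //.
  by apply: ler_pM; rewrite ?expR_ge0.
rewrite ler_expR (_ : x / (4 * beta) = 2^-1 / 2 * (x / beta)); last by field; rewrite gt_eqF.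
apply: ler_wpM2l; first lra.
by apply: ler_wpM2r => //; rewrite invr_ge0 ltW.
Qed.

(** * Growth of balls in Maker's graph *)

Variables (d k : nat) (X : R).
Hypothesis k2 : (2 <= k)%N.
Hypothesis kd : (k.*2 <= d.+1)%N.
Hypothesis X_large : 20 + 10 * d%:R <= X.
Hypothesis nX : n%:R = X ^+ k * L.
Hypothesis betaE : beta = X ^+ k.-1 / (2 * d%:R).

Let A := adj M.
Lemma parameter_bounds :
  0 < beta /\
  [/\ 3 <= d%:R :> R, 20 + 10 * d%:R <= X, 0 < X, 1 <= L &
      n%:R = 2 * d%:R * X * L * beta].
Proof.
have d3 : 3 <= d%:R :> R by rewrite (ler_nat R 3 d); lia.
have X0 : 0 < X by move: X_large; lra.
split=> //; split=> //; last first.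
  rewrite nX betaE -[k in X ^+ k](@prednK k) ?exprS; last by lia.
  by field; lra.
have n0 : 0 < n%:R :> R by rewrite ltr0n; apply: leq_trans n12.
have n12R : 12 <= n%:R :> R by rewrite (ler_nat R 12 n).
rewrite leNgt; apply/negP => l1.
have l2 : L / 2 <= 2^-1 by lra.
have e2 : expR (L / 2) <= 2.
  apply: (@le_trans _ _ (expR 2^-1)); first by rewrite ler_expR.
  by apply: le_trans (expR_le1D2x _) _; lra.
have : expR (L / 2) ^+ 2 <= 2 ^+ 2 by rewrite lerXn2r ?nnegrE ?expR_ge0 //.
rewrite -expRM_natl mulrC divfK ?pnatr_eq0 // -nL -natrX; lra.
Qed.

(** Starting from degrees of order [n / beta] yields the factor [L] that the balls
    keep at each later step; growth from a single vertex by heavy pairs would give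
    only a multiple of [X]. The factor [14 / 10] lies between the [4 / 3] from
    which two balls of the last radius form a heavy pair, and the [d / 2 >= 3 / 2]
    up to which the final weights of the stars allow it. *)
Lemma ball1_large v : 14 / 10 * X * L <= #|wball A 1 v|%:R.
Proof.
have [beta0 [d3 Xd X0 L1 n_beta]] := parameter_bounds.
apply: (@le_trans _ _ #|(M :&: star v)%SET|%:R); last first.
  rewrite card_star_cap // ler_nat; apply: subset_leq_card; apply/subsetP => z.
  by rewrite inE => /wball_edge.
have := final_degree v; set D := (#|_|%:R : R) => H.
rewrite leNgt; apply/negP => DX.
have D0 : 0 <= D by apply: ler0n.
have Xbeta : X / (2 * d%:R) <= beta.
  rewrite betaE ler_pM2r ?invr_gt0; last lra.
  rewrite -[X in X <= _]expr1; apply: ler_weXn2l; first lra.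
  by rewrite -ltnS prednK // ltnW.
have inv_beta : (4 * beta)^-1 <= d%:R / (2 * X).
  rewrite (_ : d%:R / (2 * X) = (4 * (X / (2 * d%:R)))^-1); last by field; lra.
  by rewrite lef_pV2 ?posrE ?mulr_gt0 ?ler_pM2l // invr_gt0; lra.
have n1 : n.-1%:R = n%:R - 1 :> R by rewrite -subn1 natrB //; apply: leq_trans n12.
have E : (n.-1%:R - D) / (4 * beta) = d%:R * X * L / 2 - (1 + D) * (4 * beta)^-1.
  by rewrite n1 n_beta; field; lra.
have loss : (1 + D) * (4 * beta)^-1 <= d%:R * L.
  apply: (@le_trans _ _ ((1 + 14 / 10 * X * L) * (d%:R / (2 * X)))).
    by apply: ler_pM; rewrite ?invr_ge0; lra.
  have -> : (1 + 14 / 10 * X * L) * (d%:R / (2 * X)) = d%:R / (2 * X) + 7 / 10 * d%:R * L.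
    by field; lra.
  have : d%:R / (2 * X) <= d%:R * 10^-1.
    by apply: ler_wpM2l; rewrite ?lef_pV2 ?posrE; lra.
  have : d%:R <= d%:R * L by rewrite ler_peMr; lra.
  lra.
have XL : 0 <= X * L by rewrite mulr_ge0; lra.
have dXL : 3 * (X * L) <= d%:R * (X * L) by apply: ler_wpM2r.
have XLL : (20 + 10 * d%:R) * L <= X * L by apply: ler_wpM2r => //; lra.
rewrite E in H; lra.
Qed.

(** Maker has no edge between the ball of radius [j] and the complement of the
    next one, so this pair cannot be heavy; and it would be if the next ball were
    smaller than stated. A step with [j.+1 < k] exists only for [3 <= k], so that
    [5 <= d]: this is what leaves room in the constants. *)
Lemma ball_grows v j : (1 <= j)%N -> (j.+1 < k)%N ->
  14 / 10 * X ^+ j * L <= #|wball A j v|%:R ->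
  14 / 10 * X ^+ j.+1 * L <= #|wball A j.+1 v|%:R.
Proof.
have [beta0 [d3 Xd X0 L1 n_beta]] := parameter_bounds.
move=> j1 jk; set S := wball A j v; set Q := wball A j.+1 v => Sl.
rewrite leNgt; apply/negP => Ql.
have SQ : S \subset Q by apply: sub_wball.
have S0 : S != set0 by apply/set0Pn; exists v; apply: wball_center.
have dSQ : [disjoint S & far_end false Q].
  by rewrite /= disjoint_sym disjoints_subset finset.setCS.
have : ~~ heavy (false, S, Q).
  apply/negP => /heavy_crossed[u [w [uS]]]; rewrite /= in_setC => /negP wQ uw.
  by apply: wQ; apply/wballSP; right; exists u.
rewrite /heavy S0 dSQ /= -ltNge /decay.
have -> : #|(~: Q)%SET|%:R = n%:R - #|Q|%:R :> R.
  have : (#|Q| + #|(~: Q)%SET|)%:R = n%:R :> R by rewrite cardsC card_ord.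
  by rewrite natrD => <-; rewrite addrC addKr.
have sq : #|S|%:R <= #|Q|%:R :> R by rewrite ler_nat subset_leq_card.
move: Sl Ql sq; set s := (#|S|%:R : R); set q := (#|Q|%:R : R) => Sl Ql sq.
rewrite ltr_pdivrMr; last by lra.
move=> H; rewrite exprS in Ql.
have Xj : 0 < X ^+ j by apply: exprn_gt0.
set Z := X ^+ j in Sl Ql Xj.
have qn : X * q <= 14 / 10 * n%:R.
  have XZ : X * (X * Z) <= X ^+ k by rewrite /Z -!exprS; apply: ler_weXn2l => //; lra.
  have := ler_wpM2r (_ : 0 <= L) XZ => /(_ (ltW (lt_le_trans ltr01 L1))).
  rewrite -nX => XZL.
  have := ler_wpM2l (ltW X0) (ltW Ql).
  lra.
have n0 : 0 < n%:R :> R by rewrite ltr0n; apply: leq_trans n12.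
have q0 : 0 <= q by apply: ler0n.
have q_small : q <= 2 / 10 * n%:R.
  have : 20 * q <= X * q by apply: ler_wpM2r => //; lra.
  lra.
have d5 : 5 <= d%:R :> R.
  rewrite (ler_nat R 5 d); suff : (3.*2 <= d.+1)%N by [].
  by apply: leq_trans kd; rewrite leq_double (leq_ltn_trans _ jk).
have nb : 10 * (X * L * beta) <= n%:R.
  rewrite n_beta.
  have : 5 * (X * L * beta) <= d%:R * (X * L * beta).
    by apply: ler_wpM2r => //; rewrite !mulr_ge0 //; lra.
  lra.
have l1 : 14 / 10 * Z * L * (8 / 10 * n%:R) <= s * (n%:R - q).
  apply: ler_pM => //; [|lra].
  by rewrite !mulr_ge0 //; lra.
have Lb : 0 < L * beta by rewrite mulr_gt0 //; lra.
have l2 : 2 * (s + q) * L * (2 * beta) <= 8 * (L * beta) * q.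
  have : L * beta * s <= L * beta * q by apply: ler_wpM2l => //; lra.
  lra.
have l3 : 8 * (L * beta) * q < 8 * (L * beta) * (14 / 10 * (X * Z) * L).
  by rewrite ltr_pM2l //; lra.
have l4 : Z * L * (10 * (X * L * beta)) <= Z * L * n%:R.
  by apply: ler_wpM2l => //; rewrite mulr_ge0 //; lra.
lra.
Qed.

Lemma ball_large v : 14 / 10 * X ^+ k.-1 * L <= #|wball A k.-1 v|%:R.
Proof.
suff H j : (j.+1 < k)%N -> 14 / 10 * X ^+ j.+1 * L <= #|wball A j.+1 v|%:R.
  by have := H k.-2; rewrite (_ : k.-2.+1 = k.-1); [apply|]; lia.
elim: j => [|j IH] jk; first by rewrite expr1; apply: ball1_large.
by apply: ball_grows => //; apply: IH; apply: ltnW.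
Qed.

(** Balls of radius [k.-1] around [x] and [y] either meet or form a heavy pair;
    in both cases [x] and [y] are at distance at most [2 k - 1 <= d]. *)
Lemma maker_graph_ball x y : y \in wball A d x.
Proof.
have [beta0 [d3 Xd X0 L1 n_beta]] := parameter_bounds.
have As : symmetric A by apply: adjacent_sym.
have kd1 : (k.-1 + (1 + k.-1) <= d)%N.
  by rewrite add1n prednK ?(ltnW k2) // -ltnS -addSn prednK ?(ltnW k2) // addnn.
have := ball_large x; have := ball_large y.
set S := wball A k.-1 x; set U := wball A k.-1 y => Ul Sl.
have [dis|/pred0Pn[z /andP[/= zS]]] := boolP [disjoint S & U]; last first.
  rewrite /U (wball_sym _ _ _ As) => zU.
  apply: wball_le (wball_trans zS zU); apply: leq_trans kd1.
  by rewrite leq_add2l add1n leqnSn.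
have S0 : S != set0 by apply/set0Pn; exists x; apply: wball_center.
have hv : heavy (true, S, U).
  rewrite /heavy S0 /= dis /= /decay.
  move: Sl Ul; set s := (#|S|%:R : R); set u := (#|U|%:R : R).
  have -> : X ^+ k.-1 = 2 * d%:R * beta by rewrite betaE; field; lra.
  have bL : 0 < beta * L by rewrite mulr_gt0 //; lra.
  have dbL : 3 * (beta * L) <= d%:R * (beta * L) by rewrite ler_pM2r.
  move=> Sl Ul.
  have s1 : 84 / 10 * (beta * L) <= s by lra.
  have u1 : 84 / 10 * (beta * L) <= u by lra.
  have s0 : 0 <= s by apply: ler0n.
  have u0 : 0 <= u by apply: ler0n.
  rewrite ler_pdivlMr; last by lra.
  have p1 : 84 / 10 * (beta * L) * s <= u * s by apply: ler_wpM2r.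
  have p2 : 84 / 10 * (beta * L) * u <= s * u by apply: ler_wpM2r.
  have p3 : 0 <= beta * L * s by rewrite mulr_ge0 // ltW.
  have p4 : 0 <= beta * L * u by rewrite mulr_ge0 // ltW.
  lra.
have [u [w [uS wU uw]]] := heavy_crossed hv.
move: wU; rewrite /= /U (wball_sym _ _ _ As) => wU.
have := wball_trans uS (wball_trans (wball_edge uw) wU).
exact: wball_le.
Qed.

End FinalPosition.
End MakerPotential.

(** * Maker's bias *)

(** The condition on [n] gives [20 + 10 d <= X], as
    [n / ln n > Num.sqrt n / 2]. *)
Lemma maker_wins_large (R : realType) d n :
  (3 <= d)%N -> ((2 * (20 + 10 * d) ^ uphalf d) ^ 2 <= n)%N ->
  Maker_has_winning_strategy R d 1
    (Num.truncn ((2 * d%:R)^-1 * (n%:R / ln n%:R) `^ (1 - (uphalf d)%:R^-1) : R)) n.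
Proof.
move=> d3 nl; set k := uphalf d in nl *; set C := (20 + 10 * d)%N in nl.
have k2 : (2 <= k)%N by rewrite /k; lia.
have C_ge : (50 <= C)%N by rewrite /C; lia.
have CkC : (C <= C ^ k)%N by rewrite -{1}(expn1 C) leq_pexp2l //; lia.
have n12 : (12 <= n)%N.
  by apply: leq_trans nl; rewrite expnS expn1; nia.
have n0 : 0 < n%:R :> R by rewrite ltr0n; lia.
set L := ln n%:R.
have nL : n%:R = expR L by rewrite lnK.
have L0 : 0 < L by apply: ln_gt0; rewrite ltr1n; lia.
have t0 : 0 <= n%:R / L by rewrite divr_ge0 // ltW.
have [Xk ->] := powR_root t0 (ltnW k2).
set X := (n%:R / L) `^ k%:R^-1 in Xk *.
have X_large : C%:R <= X.
  pose s := Num.sqrt (n%:R : R).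
  have s2 : s ^+ 2 = n%:R by rewrite sqr_sqrtr // ltW.
  have s0 : 0 < s by rewrite sqrtr_gt0.
  have sC : (2 * C ^ k)%:R <= s by apply: root_large s2 nl => //; apply: ltW.
  have Ls : L < 2 * s.
    by rewrite /L -s2 lnXn // mulr_natl; have := ln_sublinear s0; lra.
  rewrite leNgt; apply/negP => XC.
  have : X ^+ k < C%:R ^+ k.
    by rewrite ltrXn2r ?nnegrE ?powR_ge0 //; lia.
  rewrite Xk ltr_pdivrMr // -natrX -s2.
  rewrite natrM in sC; set c := ((C ^ k)%:R : R) in sC *.
  have c0 : 0 <= c by [].
  have : c * L <= c * (2 * s) by rewrite ler_wpM2l // ltW.
  have : 2 * c * s <= s * s by rewrite ler_wpM2r // ltW.
  by rewrite expr2; lra.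
have nX : n%:R = X ^+ k * L by rewrite Xk divfK // gt_eqF.
have X0 : 0 < X by apply: lt_le_trans X_large; rewrite ltr0n; lia.
have d0 : 0 < d%:R :> R by rewrite ltr0n; lia.
set beta := (2 * d%:R)^-1 * X ^+ k.-1.
have beta0 : 0 < beta by rewrite mulr_gt0 ?exprn_gt0 // invr_gt0 mulr_gt0.
have betaE : beta = X ^+ k.-1 / (2 * d%:R) by rewrite /beta mulrC.
have XC : 20 + 10 * d%:R <= X by move: X_large; rewrite /C natrD natrM.
have kd : (k.*2 <= d.+1)%N by rewrite /k; lia.
have b_le : (Num.truncn beta)%:R <= beta by rewrite truncn_le ltW.
apply: (potential_wins (A := @target_edges n) beta0 b_le
  (@target_weight_ge0 R n beta L) (@target_theta01 R n)).
move=> h lh gh fin; apply/maker_wins_wball => x y.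
apply: (maker_graph_ball beta0 n12 nL (claimed_sub _ lh) _ fin k2 kd XC nX betaE).
by rewrite -setD_eq0.
Qed.

Theorem theorem4 (R : realType) :
  (forall d : nat, (3 <= d)%N ->
     exists n0 : nat, forall n : nat, (n0 <= n)%N ->
       Maker_has_winning_strategy R d 1
         (Num.truncn ((2 * d%:R)^-1 *
            (n%:R / ln n%:R) `^ (1 - (uphalf d)%:R^-1) : R)) n)
  /\
  (forall d : nat, (3 <= d)%N ->
     exists2 c2 : R, 0 < c2 &
     forall a : nat, (1 < a)%N ->
     exists2 c3 : R, 0 < c3 &
     exists n0 : nat, forall n : nat, (n0 <= n)%N ->
       Breaker_has_winning_strategy R d 1
         (Num.truncn (c2 * n%:R `^ (1 - (d%:R - 1)^-1))) n /\
       Breaker_has_winning_strategy R d a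
         (Num.truncn (c3 * n%:R `^ (1 - d%:R^-1))) n).
Proof.
split=> [d d3|[|[|e]] // e0].
  by exists ((2 * (20 + 10 * d) ^ uphalf d) ^ 2)%N => n; apply: maker_wins_large.
exists (4 * e + 14)%:R; first by rewrite ltr0n addn_gt0 orbT.
move=> a a1; exists (10 * a + 1)%:R; first by rewrite ltr0n addn_gt0 orbT.
exists (maxn (4 ^ e.+1) ((2 * a + 4) ^ e.+2)) => n; rewrite geq_max => /andP[n1 n2].
by split; [apply: breaker_wins_single_bias|apply: breaker_wins_small_bias].
Qed.
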